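(* Let $\mathcal{A} \subset \omega^\omega$ be an a.d. family which is analytic as a subset of $\omega^\omega$, and let $X \in [\omega \times \omega]^\omega$ avoid $\mathcal{A}$. Then there is $Y \in [X]^\omega$ such that $|h \cap Y| < \omega$ for every $h \in \mathcal{A}$.
   Context: Functions are identified with their graphs (subsets of $\omega\times\omega$). An a.d. family $\mathcal{A} \subset \omega^\omega$ is one with $|f \cap g| < \omega$ for all distinct $f,g \in \mathcal{A}$. $\omega^\omega$ carries the Baire space topology. A set $X \in [\omega\times\omega]^\omega$ avoids a family $\mathcal{A}$ of subsets of $\omega\times\omega$ if for every finite collection $\{h_0, \dots, h_n\} \subset \mathcal{A}$, $|X \setminus (h_0 \cup \dots \cup h_n)| = \omega$. *)

(* Defs.v *)
From HB Require Import structures.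
From mathcomp Require Import all_boot all_order.
From mathcomp Require Import boolp classical_sets functions cardinality topology.

Set Implicit Arguments.
Unset Strict Implicit.
Unset Printing Implicit Defensive.

Local Open Scope classical_set_scope.

(* [nat] is discrete and [{ptws _ -> _}] carries the product topology. *)
Notation baire_space := {ptws nat -> nat}.

Definition graph (f : nat -> nat) : set (nat * nat) := [set p | f p.1 = p.2].

Definition almost_disjoint (A : set baire_space) : Prop :=
  forall f g, A f -> A g -> f <> g -> finite_set (graph f `&` graph g).

(* The empty set is analytic but is not a continuous image of the (nonempty)
   Baire space, hence the first disjunct. *)
Definition analytic (A : set baire_space) : Prop :=
  A = set0 \/
  exists2 F : baire_space -> baire_space, continuous F & range F = A.

Definition avoids (X : set (nat * nat)) (H : set (set (nat * nat))) : Prop :=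
  forall (n : nat) (h : 'I_n.+1 -> set (nat * nat)),
    (forall i, H (h i)) -> infinite_set (X `\` \bigcup_i h i).

(* Main.v *)
Require Import Defs.
From mathcomp Require Import all_boot all_order.
From mathcomp Require Import boolp classical_sets functions cardinality topology.

(* Suppose that every infinite subset of X has infinite intersection with some
   member of A = range F.  Then, as for the coideal of a MAD family (Mathias),
   decreasing sequences of positive sets, i.e. sets avoiding A, have positive
   pseudo-intersections.  A fusion over the countably many basic open sets N_s
   yields a positive Z such that, for each s, either Z is almost disjoint from
   every member of F[N_s], or every positive Y <= Z has infinite intersection
   with some member of F[N_s].  Call x good if F x meets Z in an infinite set.
   If x is good, the points of Z that lie on no F x' with x' good and close to x
   form a non-positive set.  Hence two good branches can be moved slightly to
   good branches whose images share one more point of Z; in the limit, starting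
   from good x, y with F x <> F y, two distinct members of A have infinite
   intersection. *)

Local Open Scope classical_set_scope.

(** * Infinite sets and transversals *)

Lemma infinite_inj_image {T U : Type} (p : T -> U) (J : set T) :
  injective p -> infinite_set J -> infinite_set (p @` J).
Proof.
move=> pI iJ fpJ; apply: iJ.
by rewrite -(eq_finite_set (inj_card_eq (in2W pI))).
Qed.

Lemma infinite_transversal {T : eqType} (E : nat -> set T) :
  (forall n, infinite_set (E n)) ->
  exists2 p : nat -> T, injective p & forall n, E n (p n).
Proof.
move=> iE.
have /choice[g gP] : forall u : nat * seq T,
    exists x, E u.1 x /\ x \notin u.2.
  move=> [n l] /=.
  have /infinite_setN0[x [Ex /negP xl]] := infinite_setD (iE n) (finite_seq l).
  by exists x.
(* The points are chosen greedily: [L n] lists those chosen for the indices below [n], and the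
   choice at [n] omits them. *)
pose fix L n := if n is m.+1 then g (m, L m) :: L m else [::].
have LP i d : g (i, L i) \in L (i + d).+1.
  elim: d => [|d IH]; first by rewrite addn0 mem_head.
  by rewrite addnS /= in_cons IH orbT.
have ltI i j : (i < j)%N -> g (i, L i) <> g (j, L j).
  move=> ij eg; have := (gP (j, L j)).2; rewrite -eg /=.
  by rewrite -(subnKC ij) addSn LP.
exists (fun n => g (n, L n)) => [i j eg|n]; last exact: (gP (n, L n)).1.
by case: (ltngtP i j) => // /ltI; [|move/nesym].
Qed.

(** * Positive sets, pseudo-intersections and fusion *)

(** This is the coideal of the ideal generated by [H] and the finite sets. The empty [B] is allowed,
    so that positivity includes infinitude. *)
Definition positive {T : Type} (H : set (set T)) (Y : set T) : Prop :=
  forall B : set (set T), finite_set B -> B `<=` H ->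
    infinite_set (Y `\` \bigcup_(b in B) b).

Definition pairwise_ad {T : Type} (H : set (set T)) : Prop :=
  forall g h, H g -> H h -> g <> h -> finite_set (g `&` h).

Lemma positive_infinite {T : Type} (H : set (set T)) (Y : set T) :
  positive H Y -> infinite_set Y.
Proof.
move=> /(_ set0 (finite_set0 _) (@sub0set _ _)).
by rewrite bigcup_set0 setD0.
Qed.

Lemma positiveS {T : Type} (H : set (set T)) (Y Z : set T) :
  finite_set (Y `\` Z) -> positive H Y -> positive H Z.
Proof.
move=> fYZ pY B fB BH; have := infinite_setD (pY B fB BH) fYZ.
apply: sub_infinite_set => x [[Yx Bx] YZx]; split=> //.
by apply: contrapT => Zx; apply: YZx.
Qed.

Lemma positiveU {T : Type} (H : set (set T)) (Y Z : set T) :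
  positive H (Y `|` Z) -> positive H Y \/ positive H Z.
Proof.
move=> pYZ; apply: contrapT => /not_orP[].
move=> /existsNP[B /not_implyP[fB /not_implyP[BH /contrapT fYB]]].
move=> /existsNP[C /not_implyP[fC /not_implyP[CH /contrapT fZC]]].
apply: (pYZ (B `|` C)).
- by rewrite finite_setU.
- by rewrite subUset.
rewrite bigcup_setU setDUl finite_setU; split.
  by apply: sub_finite_set fYB => x [Yx nx]; split=> // Bx; apply: nx; left.
by apply: sub_finite_set fZC => x [Yx nx]; split=> // Bx; apply: nx; right.
Qed.

Lemma nonincreasing_subset {T : Type} (Z : nat -> set T) (m n : nat) :
  (forall k, Z k.+1 `<=` Z k) -> (m <= n)%N -> Z n `<=` Z m.
Proof.
move=> Zdec /subnKC <-; elim: (n - m)%N => [|d IH]; first by rewrite addn0.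
by rewrite addnS; apply: subset_trans IH.
Qed.

Lemma finite_range_setD {T : Type} (Z : nat -> set T) (p : nat -> T) (n : nat) :
  (forall k, Z k.+1 `<=` Z k) -> (forall k, Z k (p k)) ->
  finite_set (range p `\` Z n).
Proof.
move=> Zdec Zp; apply: (@sub_finite_set _ _ (p @` `I_n)); last first.
  exact/finite_image/finite_II.
move=> _ [[k _ <-] nZ]; exists k => //=; rewrite ltnNge; apply/negP => nk.
by apply: nZ; apply: (nonincreasing_subset Z n k).
Qed.

(** Maximality of [H] below [X]; for the graphs of [A] it is the negation of the theorem's
    conclusion. *)
Definition nowhere_ad {T : Type} (H : set (set T)) (X : set T) : Prop :=
  forall Y, Y `<=` X -> infinite_set Y -> exists2 h, H h & infinite_set (h `&` Y).

Lemma infinite_common_meets {T : eqType} (H : set (set T)) (Z : nat -> set T) :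
  nowhere_ad H (Z 0%N) -> (forall k, Z k.+1 `<=` Z k) ->
  (forall k, positive H (Z k)) ->
  infinite_set [set h | H h /\ forall k, infinite_set (h `&` Z k)].
Proof.
set M := [set h | _] => nadH Zdec Zpos fM.
have MH : M `<=` H by move=> h [].
(* A member of H meeting a pseudo-intersection of W lies in M, but W omits M. *)
pose W k := Z k `\` \bigcup_(b in M) b.
have [p pI Wp] := infinite_transversal W (fun k => Zpos k M fM MH).
have Wdec k : W k.+1 `<=` W k by move=> x [/Zdec].
have rW : range p `<=` W 0%N.
  by move=> _ [k _ <-]; apply: (nonincreasing_subset W 0 k).
have [h Hh ih] := nadH (range p) (subset_trans rW (@subDsetl _ _ _))
  (infinite_inj_image p _ pI infinite_nat).
have /infinite_setN0[x [hx px]] := ih.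
apply: (rW x px).2; exists h => //; split=> // k.
apply: sub_infinite_set (infinite_setD ih (finite_range_setD W p k Wdec Wp)).
move=> y [[hy py] nW]; split=> //.
by have [[]|nWy] := pselect (W k y); last case: nW.
Qed.

(** Take distinct [h n] in [H] meeting every [Z k] in an infinite set, and let [Y] collect
    infinitely many points of each, the [n]-th point coming from [Z n]. A finite [B] omits some
    [h i], which is almost disjoint from the union of [B], so infinitely many points of [Y] on [h i]
    survive. *)
Lemma positive_pseudo_intersection {T : eqType} (H : set (set T))
    (Z : nat -> set T) :
  pairwise_ad H -> nowhere_ad H (Z 0%N) -> (forall k, Z k.+1 `<=` Z k) ->
  (forall k, positive H (Z k)) ->
  exists Y, [/\ Y `<=` Z 0%N, positive H Y & forall k, finite_set (Y `\` Z k)].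
Proof.
move=> adH nadH Zdec Zpos.
have iM := infinite_common_meets H Z nadH Zdec Zpos.
have /infiniteP/pcard_leP/unsquash h := iM.
have hI : injective h by move=> i j; apply: inj; rewrite inE.
have hM n : H (h n) /\ forall k, infinite_set (h n `&` Z k).
  exact: (@funS _ _ setT _ h n I).
(* [j] takes every value infinitely often. *)
pose j n := (odflt (0, 0)%N (unpickle n)).1.
have [p pI pE] := infinite_transversal (fun n => h (j n) `&` Z n)
  (fun n => (hM (j n)).2 n).
have pZ n : Z n (p n) by have [] := pE n.
exists (range p); split; last by move=> k; apply: finite_range_setD.
  by move=> _ [k _ <-]; apply: (nonincreasing_subset Z 0 k).
move=> B fB BH.
have /infinite_setN0[_ [[i _ <-] nBi]] :=
  infinite_setD (infinite_inj_image h _ hI infinite_nat) fB.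
have ip : infinite_set (p @` (j @^-1` [set i])).
  apply: infinite_inj_image => //.
  pose c (k : nat) := pickle (i, k).
  have cI : injective c by move=> k l /(pcan_inj pickleK)[].
  apply: sub_infinite_set (infinite_inj_image c _ cI infinite_nat).
  by move=> _ [k _ <-]; rewrite /= /j pickleK.
have fhB : finite_set (h i `&` \bigcup_(b in B) b).
  rewrite setI_bigcupr; apply: bigcup_finite => // b Bb.
  by apply: adH; [exact: (hM i).1|exact: BH|move=> hb; apply: nBi; rewrite hb].
apply: sub_infinite_set (infinite_setD ip fhB).
move=> _ [[k /= jk <-] nhB]; split; first by exists k.
by move=> Bp; apply: nhB; split=> //; rewrite -jk; have [] := pE k.
Qed.

(** Stage [k] passes to a positive subset almost disjoint from all of [C k] if there is one. A
    positive pseudo-intersection inherits every decision, because both alternatives ignore finite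
    changes. *)
Lemma positive_decide {T : eqType} (H : set (set T)) (X : set T)
    (C : nat -> set (set T)) :
  pairwise_ad H -> nowhere_ad H X -> positive H X ->
  exists Z, [/\ Z `<=` X, positive H Z &
    forall k, (forall h, C k h -> finite_set (h `&` Z)) \/
      (forall Y, Y `<=` Z -> positive H Y ->
        exists2 h, C k h & infinite_set (h `&` Y))].
Proof.
move=> adH nadH posX.
pose ad k (Y : set T) := forall h, C k h -> finite_set (h `&` Y).
have /choice[g gP] : forall u : nat * set T, exists Z,
    [/\ Z `<=` u.2, positive H u.2 -> positive H Z &
      ad u.1 Z \/ forall Y, Y `<=` u.2 -> positive H Y -> ~ ad u.1 Y].
  move=> [k Z] /=.
  have [[Y [YZ pY adY]]|nY] :=
      pselect (exists Y, [/\ Y `<=` Z, positive H Y & ad k Y]).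
    by exists Y; split=> //; left.
  by exists Z; split=> //; right => Y YZ pY adY; apply: nY; exists Y.
pose fix Z n := if n is m.+1 then g (m, Z m) else X.
have Zdec n : Z n.+1 `<=` Z n by have [] := gP (n, Z n).
have Zpos n : positive H (Z n).
  by elim: n => // n IH /=; have [_ + _] := gP (n, Z n); apply.
have [Y [YX pY YZ]] := positive_pseudo_intersection H Z adH nadH Zdec Zpos.
exists Y; split=> // k; have [_ _ /= [adk|nad]] := gP (k, Z k).
  left=> h Ch; apply: (@sub_finite_set _ _ ((h `&` Z k.+1) `|` (Y `\` Z k.+1))).
    move=> x [hx Yx]; have [Zx|nZx] := pselect (Z k.+1 x); first by left.
    by right.
  by rewrite finite_setU; split; [exact: adk|exact: YZ].
right=> W WY pW; apply: contrapT => nW.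
(* [W] is only almost contained in [Z k], so the decision made there is applied to the trace of
   [W]. *)
apply: (nad (W `&` Z k) (@subIsetr _ _ _)).
  apply: positiveS pW; apply: sub_finite_set (YZ k).
  by move=> x [Wx nWx]; split; [exact: WY|move=> Zx; apply: nWx].
move=> h Ch; apply: contrapT => ih; apply: nW; exists h => //.
by apply: sub_infinite_set ih; apply: setIS.
Qed.

(** * Basic neighbourhoods and limits in Baire space *)

Definition agree (m : nat) (x y : nat -> nat) : Prop :=
  forall i, (i < m)%N -> x i = y i.

Lemma agree_cvg (x : baire_space) (y : nat -> baire_space) :
  (forall m, agree m x (y m)) -> y n @[n --> \oo] --> x.
Proof.
move=> xy; apply/pointwise_cvgP => i U /nbhs_singleton Uxi.
exists i.+1 => // m im /=; rewrite -(xy m i im); exact: Uxi.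
Qed.

(** Otherwise some sequence converges to [x] while its images differ from [F x] at [n], although
    singletons of [nat] are open. *)
Lemma continuous_modulus (F : baire_space -> baire_space) (x : baire_space)
    (n : nat) :
  continuous F -> exists m, forall y, agree m x y -> F y n = F x n.
Proof.
move=> Fc; apply: contrapT => nm.
have /choice[y yP] : forall m, exists y : baire_space,
    agree m x y /\ F y n <> F x n.
  move=> m; apply: contrapT => ny; apply: nm; exists m => y xy.
  by apply: contrapT => Fy; apply: ny; exists y.
have yx : y k @[k --> \oo] --> x by apply: agree_cvg => m; exact: (yP m).1.
have Uopen : nbhs (F x n) [set F x n] by rewrite nbhs_principalE.
have [N _ /(_ N (leqnn N))] := yx _ (Fc x _ (@proj_continuous _ _ n (F x) _ Uopen)).
exact: (yP N).2.
Qed.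

Lemma agree_trans (m n : nat) (x y z : nat -> nat) :
  (m <= n)%N -> agree m x y -> agree n y z -> agree m x z.
Proof. by move=> mn xy yz i im; rewrite xy// yz// (leq_trans im). Qed.

Lemma agree_limit (x : nat -> nat -> nat) (m : nat -> nat) :
  (forall n, agree (m n) (x n) (x n.+1)) -> (forall n, m n < m n.+1)%N ->
  exists z, forall n, agree (m n) (x n) z.
Proof.
move=> xS mS; have mD n d : (m n + d <= m (n + d))%N.
  by elim: d => [|d IH]; rewrite ?addn0// !addnS (leq_ltn_trans IH).
have xD n d : agree (m n) (x n) (x (n + d)%N).
  elim: d => [|d IH]; first by rewrite addn0.
  rewrite addnS; apply: agree_trans IH (xS _).
  exact: leq_trans (leq_addr d _) (mD n d).
(* Since [m i.+1] exceeds [i], the value at [i] is frozen from stage [i.+1] on. *)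
exists (fun i => x i.+1 i) => n i im; have [ni|ni] := leqP n i.+1.
  by rewrite -(subnKC ni); apply: xD.
rewrite -(subnKC (ltnW ni)); apply/esym/xD.
exact: leq_trans (leq_addl _ _) (mD 0%N i.+1).
Qed.

(** * Merging two good branches *)

Lemma common_point (F : baire_space -> baire_space) (H : set (set (nat * nat)))
    (Z : set (nat * nat)) :
  let meets x := infinite_set (graph (F x) `&` Z) in
  positive H Z ->
  (forall x m Y, meets x -> Y `<=` Z -> positive H Y ->
    exists2 x', agree m x x' & infinite_set (graph (F x') `&` Y)) ->
  forall x y m (L : set (nat * nat)), meets x -> meets y -> finite_set L ->
  exists x' y' p, [/\ agree m x x' /\ meets x', agree m y y' /\ meets y',
    ~ L p, graph (F x') p & graph (F y') p].
Proof.
move=> meets posZ dense x y m L ix iy fL.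
pose P u := [set p | exists2 v, agree m u v /\ meets v & graph (F v) p].
have nP u : meets u -> ~ positive H (Z `\` P u).
  (* Density gives a branch [v] near [u] whose image has infinitely many points in the set [Z] minus
     [P u]. Then [v] is good, so these points lie in [P u], a contradiction. *)
  move=> iu pos; have [v uv iv] := dense u m _ iu (@subDsetl _ _ _) pos.
  have /infinite_setN0[p [vp [Zp nPp]]] := iv; apply: nPp; exists v => //.
  by split=> //; apply: sub_infinite_set iv; apply: setIS; exact: subDsetl.
have [/(nP x ix)//|pos] : positive H (Z `\` P x) \/ positive H (Z `&` P x).
  by apply: positiveU; rewrite setUC setUIDK.
have [posy|/positive_infinite iP] :
    positive H ((Z `&` P x) `\` P y) \/ positive H ((Z `&` P x) `&` P y).
- by apply: positiveU; rewrite setUC setUIDK.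
- case: (nP y iy); apply: positiveS posy.
  by rewrite (_ : _ `\` _ = set0)// setD_eq0 => p [[Zp _] nPy].
have /infinite_setN0[p [[[_ [x' xx' x'p]] [y' yy' y'p]] nLp]] := infinite_setD iP fL.
by exists x', y', p.
Qed.

(** An approximation to the two limit branches: their first [depth] values are fixed, and these are
    to force the points of [common] onto both images. *)
Record stage := Stage {
  lbranch : baire_space; rbranch : baire_space;
  depth : nat; common : seq (nat * nat) }.

Lemma merge_branches (F : baire_space -> baire_space)
    (meets : set baire_space) (x y : baire_space) (m : nat) :
  continuous F ->
  (forall x y m (L : set (nat * nat)), meets x -> meets y -> finite_set L ->
    exists x' y' p, [/\ agree m x x' /\ meets x', agree m y y' /\ meets y',
      ~ L p, graph (F x') p & graph (F y') p]) ->
  meets x -> meets y ->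
  exists x' y', [/\ agree m x x', agree m y y' &
    infinite_set (graph (F x') `&` graph (F y'))].
Proof.
move=> Fc ext ix iy.
pose forces k u p := forall z, agree k u z -> graph (F z) p.
have forcing u p : graph (F u) p -> exists k, forces k u p.
  move=> up; have [k kP] := continuous_modulus F u p.1 Fc.
  by exists k => z /kP; rewrite /graph /= => ->.
have forces_le j k u v p : (j <= k)%N -> agree j u v -> forces j u p ->
    forces k v p.
  by move=> jk uv jp z vz; apply: jp; apply: agree_trans uv vz.
pose valid s := [/\ meets (lbranch s), meets (rbranch s), uniq (common s) &
  forall p, p \in common s ->
    forces (depth s) (lbranch s) p /\ forces (depth s) (rbranch s) p].
pose extends s t := [/\ agree (depth s) (lbranch s) (lbranch t),
  agree (depth s) (rbranch s) (rbranch t), (depth s < depth t)%N &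
  size (common t) = (size (common s)).+1].
have /choice[g gP] : forall s, exists t, valid s -> valid t /\ extends s t.
  move=> s; have [vs|] := pselect (valid s); last by exists s.
  case: s vs => u v k l [/= iu iv ul fl].
  have [u' [v' [p [[uu' iu'] [vv' iv'] /negP pl u'p v'p]]]] :=
    ext u v k _ iu iv (finite_seq l).
  have [[a aP] [b bP]] := (forcing _ _ u'p, forcing _ _ v'p).
  (* The term [k.+1] makes the depth grow; [a] and [b] are the moduli that keep [p] on both images
     in the limit. *)
  exists (Stage u' v' (maxn k.+1 (maxn a b)) (p :: l)) => _.
  have [] : [/\ (k < maxn k.+1 (maxn a b)), (a <= maxn k.+1 (maxn a b)) &
      (b <= maxn k.+1 (maxn a b))]%N.
    by rewrite !leq_max !leqnn !orbT.
  move: (maxn _ _) => k' kk' ak' bk'; split; last by split.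
  split=> //=; first by rewrite pl.
  move=> q; rewrite inE => /orP[/eqP ->|/fl[lq rq]]; split.
  - exact: (forces_le a k' u').
  - exact: (forces_le b k' v').
  - exact: (forces_le k k' u u' q (ltnW kk')).
  - exact: (forces_le k k' v v' q (ltnW kk')).
pose s n := iter n g (Stage x y m [::]).
have sP n : valid (s n) /\ extends (s n) (s n.+1).
  have vs : valid (s n).
    elim: n => [|n IH]; first by split.
    exact: (gP _ IH).1.
  by split=> //; have [] := gP _ vs.
have [x' xx'] : exists z, forall n, agree (depth (s n)) (lbranch (s n)) z.
  by apply: agree_limit => n; have [_ []] := sP n.
have [y' yy'] : exists z, forall n, agree (depth (s n)) (rbranch (s n)) z.
  by apply: agree_limit => n; have [_ []] := sP n.
exists x', y'; split; [exact: (xx' 0%N)|exact: (yy' 0%N)|].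
(* If [l] listed the intersection, stage [(size l).+1] would already put more distinct points into
   it than [l] has entries. *)
move=> /finite_seqP[l lE].
have ss n : size (common (s n)) = n.
  by elim: n => // n IH; have [_ [_ _ _ ->]] := sP n; rewrite IH.
have [[_ _ ul fl] _] := sP (size l).+1.
suff : (size (common (s (size l).+1)) <= size l)%N by rewrite ss ltnn.
apply: uniq_leq_size => // p /fl[lp rp].
suff : [set` l] p by [].
by rewrite -lE; split; [apply: lp|apply: rp].
Qed.

(** * Application to an analytic family *)

(** [avoids] ranges over nonempty finite families; the empty one is covered by the infinitude of
    [X]. *)
Lemma avoids_positive (H : set (set (nat * nat))) (X : set (nat * nat)) :
  infinite_set X -> avoids X H -> positive H X.
Proof.
move=> iX avX B /finite_setP[[|n] Bn] BH.
  by move: Bn; rewrite II0 card_eq0 => /eqP ->; rewrite bigcup_set0 setD0.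
move: Bn; rewrite card_eq_sym => /pcard_eqP/unsquash h.
have := avX n (fun i => h i) (fun i => BH _ (@funS _ _ _ _ h i (ltn_ord i))).
apply: sub_infinite_set => p [Xp nBp]; split=> // -[b Bb bp].
have [i ni hi] := @surj _ _ _ _ h b Bb.
by apply: nBp; exists (Ordinal ni) => //; rewrite /= hi.
Qed.

Theorem theorem3 (A : set baire_space) (X : set (nat * nat)) :
  almost_disjoint A -> analytic A ->
  infinite_set X -> avoids X (graph @` A) ->
  exists Y : set (nat * nat),
    [/\ Y `<=` X, infinite_set Y &
        forall h, A h -> finite_set (graph h `&` Y)].
Proof.
move=> adA [->|[F Fc FA]] iX avX; first by exists X; split=> // h [].
apply: contrapT => nY; pose H := graph @` A.
have adH : pairwise_ad H.
  by move=> _ _ [f Af <-] [g Ag <-] fg; apply: adA => // /(congr1 graph).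
have nadH : nowhere_ad H X.
  move=> Y YX iY; apply: contrapT => nh; apply: nY; exists Y; split=> // h Ah.
  by apply: contrapT => ih; apply: nh; exists (graph h) => //; exists h.
(* Next, finite sequences are coded by numbers, so that the [C k] include the images under [F] of
   all basic open sets. *)
have AF x : A (F x) by rewrite -FA; exists x.
pose code m (x : nat -> nat) := pickle (mkseq x m).
pose C k := [set graph (F x) | x in [set x | exists m, code m x = k]].
have [Z [ZX posZ dec]] :=
  positive_decide H X C adH nadH (avoids_positive H X iX avX).
pose meets x := infinite_set (graph (F x) `&` Z).
have dense x m Y : meets x -> Y `<=` Z -> positive H Y ->
    exists2 x', agree m x x' & infinite_set (graph (F x') `&` Y).
  move=> ix YZ pY; have [ad|/(_ Y YZ pY)] := dec (code m x).
    by case: ix; apply: ad; exists x => //; exists m.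
  move=> [_ [x' [m' cE] <-] ix']; exists x' => // i im.
  have /(pcan_inj pickleK) sE := cE.
  have mE : m' = m by rewrite -(size_mkseq x' m') sE size_mkseq.
  by rewrite -(nth_mkseq 0%N x im) -sE mE nth_mkseq.
(* The part of [Z] off the union of [B] is infinite, hence meets some member of [H] in an infinite
   set; that member cannot belong to [B]. *)
have meets_off B : finite_set B -> B `<=` H ->
    exists2 x, meets x & ~ B (graph (F x)).
  move=> fB BH; have [] := nadH (Z `\` \bigcup_(b in B) b).
  - by move=> p [/ZX].
  - exact: posZ.
  move=> _ [f + <-]; rewrite -FA => -[x _ <-] ix; exists x.
    by apply: sub_infinite_set ix; apply: setIS => p [].
  have /infinite_setN0[p [xp [_ nBp]]] := ix.
  by move=> Bx; apply: nBp; exists (graph (F x)).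
have [x ix _] := meets_off set0 (finite_set0 _) (@sub0set _ _).
have [y iy xy] : exists2 y, meets y & ~ [set graph (F x)] (graph (F y)).
  by apply: meets_off; [exact: finite_set1|move=> _ ->; exists (F x)].
have [n Fn] : exists n, F x n <> F y n.
  apply: contrapT => nn; apply: xy; rewrite /= (_ : F y = F x)//.
  by apply/funext => n; apply: contrapT => Fn; apply: nn; exists n => /esym.
(* Agreement up to [maxn a b] preserves the values of both images at [n], so the merged branches
   still have distinct images. *)
have [[a aP] [b bP]] := (continuous_modulus F x n Fc, continuous_modulus F y n Fc).
have [x' [y' [xx' yy' ixy]]] := merge_branches F meets x y (maxn a b) Fc
  (common_point F H Z posZ dense) ix iy.
apply: ixy; apply: adA => // Fxy; apply: Fn.
have <- : F x' n = F x n.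
  by apply: aP => i ia; apply: xx'; rewrite leq_max ia.
by rewrite Fxy; apply: bP => i ib; apply: yy'; rewrite leq_max ib orbT.
Qed.
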